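(* Let $\Gamma=(P,\mathcal{L})$ be a point-line geometry satisfying the Exchange Property (EP). Then every well ordered chain of subspaces of $\Gamma$ is contained in a maximal well ordered chain of subspaces of $\Gamma$ (that is, in a well ordered chain of subspaces which is maximal, with respect to inclusion of chains, among all well ordered chains of subspaces of $\Gamma$).
   Context: A point-line geometry is a pair $\Gamma=(P,\mathcal{L})$ where $P$ (points) is a non-empty set and $\mathcal{L}$ (lines) is a family of subsets of $P$, each containing at least two points. A subspace of $\Gamma$ is a subset $S\subseteq P$ such that every line meeting $S$ in at least two points is contained in $S$ (so $\emptyset$ and $P$ are subspaces). For $X\subseteq P$, $\langle X\rangle$ is the smallest subspace containing $X$. Exchange Property (EP): for all $X\subseteq P$ and $x,y\in P$, if $y\in\langle X\cup\{x\}\rangle$ but $y\notin\langle X\rangle$, then $x\in\langle X\cup\{y\}\rangle$. A chain of subspaces is a set of subspaces totally ordered by inclusion; it is well ordered if inclusion is a well ordering on it. *)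

(* Defs.v *)
From mathcomp Require Import all_boot boolp classical_sets.

Set Implicit Arguments.
Unset Strict Implicit.
Unset Printing Implicit Defensive.

Local Open Scope classical_set_scope.

Record pointLineGeometry := PointLineGeometry {
  points : Type;
  lines : set (set points);
  points_nonempty : [set: points] !=set0;
  lines_two_points : forall l, lines l -> exists x y, [/\ l x, l y & x <> y]
}.

Section Geometry.
Variable G : pointLineGeometry.

Definition subspace (S : set (points G)) : Prop :=
  forall l, lines l ->
    (exists x y, [/\ (l `&` S) x, (l `&` S) y & x <> y]) -> l `<=` S.

Definition span (X : set (points G)) : set (points G) := smallest subspace X.

Lemma subspace_span (X : set (points G)) : subspace (span X).
Proof.
move=> l Ll [x [y [[lx Sx] [ly Sy] xy]]] z lz A [As XA].
by apply: (As l Ll) lz; exists x, y; split => //; split => //;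
  [exact: Sx | exact: Sy].
Qed.

Definition exchange_property : Prop :=
  forall (X : set (points G)) (x y : points G),
    span (X `|` [set x]) y -> ~ span X y -> span (X `|` [set y]) x.

Definition subspace_chain (C : set (set (points G))) : Prop :=
  C `<=` subspace /\ total_on C subset.

Definition well_ordered_chain (C : set (set (points G))) : Prop :=
  subspace_chain C /\
  forall D : set (set (points G)), D `<=` C -> D !=set0 ->
    exists2 S, D S & forall T, D T -> S `<=` T.

Definition maximal_well_ordered_chain (M : set (set (points G))) : Prop :=
  well_ordered_chain M /\
  forall N, well_ordered_chain N -> M `<=` N -> N = M.

End Geometry.

Arguments exchange_property : clear implicits.

(* Main.v *)
(** Well-order the points so that every member of the given chain C is an initial
    segment: compare two points first by the least member of C containing them,
    then by an arbitrary well-ordering of the points.  The spans of the initial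
    segments form a well ordered chain M containing C.  For maximality, let T be
    a subspace comparable to all members of M, let I be the largest initial
    segment whose span lies in T, and let p be the first point outside I.  Then
    span I is contained in T and T in span (I + p), and by exchange nothing lies
    strictly between these two, so T = span I is in M. *)
Require Import Defs.
From mathcomp Require Import all_boot boolp classical_sets.
From mathcomp Require wochoice.

Set Implicit Arguments.
Unset Strict Implicit.
Unset Printing Implicit Defensive.

Local Open Scope classical_set_scope.

(** Together with [antisymm] this is a well-ordering: minima of pairs and triples give totality and
    transitivity. *)
Definition has_minima {T : Type} (R : T -> T -> Prop) : Prop :=
  forall A : set T, A !=set0 -> exists2 z, A z & forall y, A y -> R z y.

Definition antisymm {T : Type} (R : T -> T -> Prop) : Prop :=
  forall x y, R x y -> R y x -> x = y.

Definition initial_segment {T : Type} (R : T -> T -> Prop) (I : set T) : Prop :=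
  forall x y, I y -> R x y -> I x.

Lemma well_ordering (T : Type) :
  exists R : T -> T -> Prop, has_minima R /\ antisymm R.
Proof.
have [R Rwo] := wochoice.well_ordering_principle {classic T}.
exists R; split=> [A [a Aa]|x y Rxy Ryx].
  have [|z [[/asboolP Az minz] _]] := Rwo (fun x => `[< A x >]).
    by exists a; apply/asboolP.
  by exists z => // y Ay; apply: minz; apply/asboolP.
have WT : @wochoice.wo_chain {classic T} R predT by move=> A _; apply: Rwo.
by apply: (wochoice.wo_chain_antisymmetric WT) => //; apply/andP.
Qed.

Lemma has_minima_total (T : Type) (R : T -> T -> Prop) :
  has_minima R -> forall x y, R x y \/ R y x.
Proof.
move=> Rmin x y; have [|z [->|->] minz] := Rmin [set x; y].
- by exists x; left.
- by left; apply: minz; right.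
- by right; apply: minz; left.
Qed.

Lemma initial_segment_total (T : Type) (R : T -> T -> Prop) :
  has_minima R -> total_on (initial_segment R) subset.
Proof.
move=> Rmin I J iI iJ.
have [|/existsNP[x /not_implyP[Ix nJx]]] := pselect (I `<=` J); first by left.
right=> y Jy; have [Rxy|Ryx] := has_minima_total Rmin x y.
  by case: nJx; apply: iJ Rxy.
exact: iI Ryx.
Qed.

(** Let [z] be the least point missed by some member [I] of [F]. All points of [I] precede [z], so
    no member of [F] misses any of them. *)
Lemma initial_segment_least (T : Type) (R : T -> T -> Prop)
    (F : set (set T)) :
  has_minima R -> F `<=` initial_segment R -> F !=set0 ->
  exists2 I, F I & forall J, F J -> I `<=` J.
Proof.
move=> Rmin iF [K FK].
have [[p Ap]|A0] := pselect ([set p | exists2 I, F I & ~ I p] !=set0).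
  have [z [I FI nIz] minz] := Rmin _ (ex_intro _ p Ap).
  exists I => // J FJ x Ix; apply: contrapT => nJx.
  by apply/nIz/(iF _ FI _ _ Ix)/minz; exists J.
exists K => // J FJ x _; apply: contrapT => nJx.
by apply: A0; exists x, J.
Qed.

(* Points lying in no member of C come last. *)
Lemma adapted_well_ordering (T : Type) (C : set (set T)) :
    (forall D, D `<=` C -> D !=set0 -> exists2 S, D S & forall U, D U -> S `<=` U) ->
  exists R : T -> T -> Prop,
    [/\ has_minima R, antisymm R & C `<=` initial_segment R].
Proof.
move=> Cwo; have [R [Rmin Ranti]] := well_ordering T.
pose below x y := forall S, C S -> S y -> S x.
(* [below] compares the least members of [C] containing the points without naming them; [R] breaks
   ties between points lying in the same members. *)
exists (fun x y => below x y /\ (below y x -> R x y)); split.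
- move=> A A0.
  have [D0|nD0] := pselect ([set S | C S /\ (A `&` S) !=set0] !=set0).
    (* The minimum of [A] is the [R]-least point of [A] in the least member of [C] meeting [A]. *)
    have [|S [CS AS0] minS] := Cwo _ _ D0; first by move=> S [].
    have [z [Az Sz] minz] := Rmin _ AS0.
    exists z => // y Ay; split=> [U CU Uy|yz].
      by apply: (minS U) => //; split=> //; exists y.
    by apply: minz; split=> //; apply: yz.
  have [z Az minz] := Rmin _ A0.
  exists z => // y Ay; split=> [U CU Uy|_]; last exact: minz.
  by case: nD0; exists U; split=> //; exists y.
- by move=> x y [xy Rxy] [yx Ryx]; apply: Ranti; [exact: Rxy|exact: Ryx].
- by move=> S CS x y Sy [xy _]; apply: xy.
Qed.

Lemma sub_span (G : pointLineGeometry) (X : set (points G)) : X `<=` span X.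
Proof. exact: sub_gen_smallest. Qed.

Lemma span_sub (G : pointLineGeometry) (X S : set (points G)) :
  subspace S -> X `<=` S -> span X `<=` S.
Proof. by move=> sS XS; apply: (smallest_sub sS). Qed.

Lemma span_mono (G : pointLineGeometry) (X S : set (points G)) :
  X `<=` S -> span X `<=` span S.
Proof.
move=> XS; apply: span_sub; first exact: subspace_span.
exact: subset_trans XS (@sub_span _ S).
Qed.

Lemma span_id (G : pointLineGeometry) (S : set (points G)) :
  subspace S -> span S = S.
Proof. exact: smallest_id. Qed.

(** A point [y] of [S] outside [span X] would, by exchange, put [p] in the span of [X] and [y],
    hence in [S]. *)
Lemma span_covers (G : pointLineGeometry) (EP : exchange_property G)
    (X S : set (points G)) (p : points G) :
  subspace S -> span X `<=` S -> S `<=` span (X `|` [set p]) -> ~ S p ->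
  S = span X.
Proof.
move=> sS XS SXp nSp; apply/seteqP; split=> // y Sy; apply: contrapT => nXy.
have XyS : X `|` [set y] `<=` S by move=> z [/sub_span/XS|->].
apply/nSp/(span_sub sS XyS); apply: EP nXy; exact: SXp.
Qed.

Definition initial_spans (G : pointLineGeometry)
    (R : points G -> points G -> Prop) : set (set (points G)) :=
  [set span I | I in initial_segment R].

Lemma initial_spans_well_ordered (G : pointLineGeometry)
    (R : points G -> points G -> Prop) :
  has_minima R -> well_ordered_chain (initial_spans R).
Proof.
move=> Rmin; split=> [|D DM [S DS]]; first split.
- by move=> _ [I _ <-]; apply: subspace_span.
- move=> _ _ [I iI <-] [J iJ <-].
  have [IJ|JI] := initial_segment_total Rmin iI iJ.
    by left; apply: span_mono.
  by right; apply: span_mono.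
(* [D] is pulled back to all initial segments with span in [D]; by monotonicity, the least of these
   has the least span. *)
- have [K iK SK] := DM _ DS.
  have [|| I [iI DI] minI] :=
    @initial_segment_least _ R [set I | initial_segment R I /\ D (span I)] Rmin.
  + by move=> I [].
  + by exists K; split=> //; rewrite SK.
  exists (span I) => // U DU; have [J iJ UJ] := DM _ DU.
  by rewrite -UJ; apply: span_mono; apply: minI; split=> //; rewrite UJ.
Qed.

Lemma initial_spans_comparable (G : pointLineGeometry)
    (EP : exchange_property G) (R : points G -> points G -> Prop)
    (S : set (points G)) :
  has_minima R -> antisymm R -> subspace S ->
  (forall U, initial_spans R U -> S `<=` U \/ U `<=` S) -> initial_spans R S.
Proof.
move=> Rmin Ranti sS cmpS.
pose I := \bigcup_(J in [set J | initial_segment R J /\ J `<=` S]) J.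
have iI : initial_segment R I.
  by move=> x y [J [iJ JS] Jy] Rxy; exists J => //; apply: iJ Rxy.
have IS : I `<=` S by move=> x [J [_ JS] /JS].
have spIS : span I `<=` S by apply: span_sub.
exists I => //; apply/esym.
have [[p nIp]|nI] := pselect ((~` I) !=set0); last first.
  apply/seteqP; split=> // x _; apply: sub_span.
  by apply: contrapT => nIx; apply: nI; exists x.
have [{nIp}p nIp minp] := Rmin _ (ex_intro _ p nIp).
(* A point outside [I] preceding [p] equals [p], by minimality of [p] and antisymmetry. *)
have iIp : initial_segment R (I `|` [set p]).
  move=> x y [Iy|->] Rxy; first by left; apply: iI Rxy.
  have [Ix|nIx] := pselect (I x); [by left|right].
  exact: Ranti Rxy (minp _ nIx).
(* Otherwise adding [p] to [I] gives a larger initial segment inside [S]. *)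
have nSp : ~ S p.
  move=> Sp; apply: nIp; exists (I `|` [set p]); last by right.
  by split=> // x [/IS|->].
apply: (span_covers EP sS spIS _ nSp).
have [//|spS] := cmpS _ (ex_intro2 _ _ _ iIp erefl).
by case: nSp; apply: spS; apply: sub_span; right.
Qed.

Theorem theorem3p7 (G : pointLineGeometry) (EP : exchange_property G)
    (C : set (set (points G))) (woC : well_ordered_chain C) :
  exists2 M, maximal_well_ordered_chain M & C `<=` M.
Proof.
have [[Csub _] Cwo] := woC.
have [R [Rmin Ranti CR]] := adapted_well_ordering Cwo.
exists (initial_spans R); last first.
  by move=> S CS; exists S; [exact: CR|apply: span_id; exact: Csub].
split=> [|N [[Nsub Ntot] _] MN]; first exact: initial_spans_well_ordered.
(* [S] is comparable to every member of [initial_spans R], since all of them lie in the chain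
   [N]. *)
apply/seteqP; split=> // S NS; apply: initial_spans_comparable => //.
  exact: Nsub.
by move=> U /MN NU; apply: Ntot.
Qed.
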